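(* Let $\tilde b(x)=\sum_{k=0}^{L-1}d_kx^k$ be the polynomial of degree $L-1$ associated with a one-step exceptional Jacobi system, let $U_k$ be the associated numbers, and for $\lambda\in\mathbb{C}$ let $$P_{2L,\lambda}(z)=\sum_{k=1}^LU_k\left(z^{L+k}+z^{L-k}\right)-\lambda z^L,\qquad \tilde P_{2L}(z)=P_{2L,\lambda}(z)+\lambda z^L.$$ Then $P_{2L,\lambda}$ has no zeros on the unit circle if and only if $$\lambda\notin\left[2\sum_{k=1}^L(-1)^kU_k,\ 2\sum_{k=1}^LU_k\right]=\left[(-1)^L\tilde P_{2L}(-1),\ \tilde P_{2L}(1)\right].$$
   Context: The polynomial $\tilde b$: let $\alpha,\beta>-1$ and let $P_N^{(\gamma,\delta)}$ be the Jacobi polynomial defined by Rodrigues' formula $(1-x)^{\gamma}(1+x)^{\delta}P_N^{(\gamma,\delta)}(x)=\frac{(-1)^N}{2^NN!}\left((1-x)^{\gamma+N}(1+x)^{\delta+N}\right)^{(N)}$. Let $b=s\,b_0$, where $b_0$ is, up to a nonzero constant factor, one of $(1-x)P_N^{(-\alpha,\beta)}(x)$, $(1+x)P_N^{(\alpha,-\beta)}(x)$, $(1-x^2)P_N^{(-\alpha,-\beta)}(x)$, and $s$ is a real polynomial with no zeros on $[-1,1]$. It is assumed that $b(x)=(1-x)^{\frac{1-\varepsilon_1}{2}}(1+x)^{\frac{1-\varepsilon_2}{2}}\tilde b(x)$ with $\varepsilon_1,\varepsilon_2\in\{-1,1\}$, where $\tilde b$ is a polynomial with $\tilde b>0$ on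 $[-1,1]$. Write $\tilde b(x)=\sum_{k=0}^{L-1}d_kx^k$, $\deg\tilde b=L-1$. The numbers $U_j$, $0\le j\le L$, are $$U_{2l}=\sum_{p=\max\{l,1\}}^{\left[\frac L2\right]}\frac{d_{2p-1}}{2p}\binom{2p}{p-l}\frac1{2^{2p}},\qquad U_{2l+1}=\sum_{p=l}^{\left[\frac{L-1}2\right]}\frac{d_{2p}}{2p+1}\binom{2p+1}{p-l}\frac1{2^{2p+1}}.$$ *)

(* Defs.v *)
From HB Require Import structures.
From mathcomp Require Import all_boot all_order all_algebra.
From mathcomp Require Import all_classical all_reals all_analysis.
From mathcomp Require Export complex.

Set Implicit Arguments.
Unset Strict Implicit.
Unset Printing Implicit Defensive.

Import Order.TTheory GRing.Theory Num.Theory.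
Local Open Scope ring_scope.
Local Open Scope complex_scope.

(* P = P_N^{(g,d)}.  Rodrigues' formula is imposed on ]-1, 1[, where the real
   powers have positive bases; this determines the polynomial P, also for
   g, d <= -1. *)
Definition is_jacobi (R : realType) (N : nat) (g d : R) (P : {poly R}) : Prop :=
  forall x : R, x \in `]-1, 1[ ->
    (1 - x) `^ g * (1 + x) `^ d * P.[x] =
    (-1) ^+ N / (2 ^+ N * N`!%:R) *
      derive1n N (fun y : R => (1 - y) `^ (g + N%:R) * (1 + y) `^ (d + N%:R)) x.

(* b0 is one of the three polynomials, up to a nonzero constant factor. *)
Definition is_b0 (R : realType) (alpha beta : R) (N : nat) (b0 : {poly R}) :
    Prop :=
  exists c : R, exists P : {poly R}, c != 0 /\
    [\/ is_jacobi N (- alpha) beta P /\ b0 = c *: ((1 - 'X) * P),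
        is_jacobi N alpha (- beta) P /\ b0 = c *: ((1 + 'X) * P) |
        is_jacobi N (- alpha) (- beta) P /\ b0 = c *: ((1 - 'X ^+ 2) * P)].

(* bt is the positive polynomial attached to b = s * b0.  For e = 1 and e = -1
   the exponent (1 - e) / 2 is 0 and 1; it is an integer quotient, turned into
   a natural number by the absolute value. *)
Definition is_btilde (R : realType) (alpha beta : R) (N : nat)
    (bt : {poly R}) : Prop :=
  exists b0 s b : {poly R}, exists e1 e2 : int,
    [/\ is_b0 alpha beta N b0,
        (forall x : R, x \in `[-1, 1] -> s.[x] != 0) /\ b = s * b0,
        (e1 = 1 \/ e1 = -1) /\ (e2 = 1 \/ e2 = -1),
        b = (1 - 'X) ^+ `|((1 - e1) %/ 2)%Z|%N
            * (1 + 'X) ^+ `|((1 - e2) %/ 2)%Z|%N * bt &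
        forall x : R, x \in `[-1, 1] -> 0 < bt.[x]].

Definition Ueven (R : realType) (d : nat -> R) (L l : nat) : R :=
  \sum_(maxn l 1 <= p < (L./2).+1)
    d (2 * p - 1)%N / (2 * p)%:R * 'C(2 * p, p - l)%:R / 2 ^+ (2 * p).

Definition Uodd (R : realType) (d : nat -> R) (L l : nat) : R :=
  \sum_(l <= p < ((L - 1)./2).+1)
    d (2 * p)%N / (2 * p + 1)%:R * 'C(2 * p + 1, p - l)%:R / 2 ^+ (2 * p + 1).

Definition U (R : realType) (d : nat -> R) (L j : nat) : R :=
  if odd j then Uodd d L j./2 else Ueven d L j./2.

Definition P2L (R : realType) (d : nat -> R) (L : nat) (lambda : R[i]) :
    {poly R[i]} :=
  \sum_(1 <= k < L.+1) (U d L k)%:C *: ('X^(L + k) + 'X^(L - k))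
  - lambda *: 'X^L.

(* By construction this does not depend on lambda. *)
Definition P2Lt (R : realType) (d : nat -> R) (L : nat) (lambda : R[i]) :
    {poly R[i]} :=
  P2L d L lambda + lambda *: 'X^L.

(* Main.v *)
Require Import Defs.
From HB Require Import structures.
From mathcomp Require Import all_boot all_order all_algebra.
From mathcomp Require Import all_classical all_reals all_analysis.
From mathcomp Require Import polyrcf.
From mathcomp Require Import zify lra.

Import Order.TTheory GRing.Theory Num.Theory.
Local Open Scope ring_scope.
Local Open Scope complex_scope.

(** Let B be the antiderivative of bt with B(0) = 0.  The U_k are the cosine
coefficients of B: expanding (cos t)^m in cosines of multiples of t gives
[[
   B(cos t) = U_0 + 2 * sum_(1 <= k <= L) U_k cos (k t).
]]
For z = exp(i t) this says P_{2L,lambda}(z) = z^L * (B(cos t) - U_0 - lambda)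
([horner_P2L]), so P_{2L,lambda} vanishes somewhere on the unit circle exactly
when lambda is a value of B - U_0 on [-1, 1].  Since B' = bt is positive there,
B - U_0 is increasing and its set of values is the real interval between its
values at -1 and 1; putting t = pi and t = 0 in the expansion identifies these
values with the alternating and the plain sum of the U_k ([sum_U_endpoint]).

The expansion is purely algebraic once cos t is written (z + z^-1) / 2, so it
is proved for every nonzero z: [addV_expn] linearizes the powers of z + z^-1,
and [sum_U_symX] collects the coefficients, using the form of U_k given by
[U_reindex]. *)

(** For z = exp(i t) this is 2 cos (k t), except that k = 0 gives 1 and not 2:
the constant term of a cosine expansion is counted once. *)
Definition symX {F : fieldType} (z : F) (k : nat) : F :=
  if k == 0%N then 1 else z ^+ k + z^-1 ^+ k.

(** The terms j and m - j of the binomial expansion are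
C(m, j) z^(m - 2j) and C(m, j) z^-(m - 2j); pairing them leaves the indices
with 2j <= m.  The middle term, present when m = 2j, is its own partner, hence
the convention at k = 0 in [symX]. *)
Lemma addV_expn (F : fieldType) (z : F) (m : nat) : z != 0 ->
  (z + z^-1) ^+ m =
  \sum_(0 <= j < m.+1 | (2 * j <= m)%N) 'C(m, j)%:R * symX z (m - 2 * j).
Proof.
move=> z0; pose w (j : nat) : F := 'C(m, j)%:R * (z ^+ (m - j) * z^-1 ^+ j).
have -> : (z + z^-1) ^+ m = \sum_(0 <= j < m.+1) w j.
  by rewrite exprDn big_mkord; apply: eq_bigr => j _; rewrite /w mulr_natl.
have wE j : (2 * j <= m)%N -> w j = 'C(m, j)%:R * z ^+ (m - 2 * j).
  move=> jm; rewrite /w.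
  have -> : (m - j = m - 2 * j + j)%N by lia.
  by rewrite exprD -mulrA -exprMn mulfV // expr1n mulr1.
have wE' j : (2 * j <= m)%N -> w (m - j)%N = 'C(m, j)%:R * z^-1 ^+ (m - 2 * j).
  move=> jm; rewrite /w bin_sub; last lia.
  have -> : (m - (m - j) = j)%N by lia.
  have -> : (m - j = j + (m - 2 * j))%N by lia.
  by rewrite exprD [z ^+ j * _]mulrA -exprMn mulfV // expr1n mul1r.
(* The middle term stays in the first sum, so the reversed second sum gets 0
   at the index 2j = m. *)
rewrite (bigID (fun j => 2 * j <= m)%N) /=.
rewrite [X in _ + X]big_nat_rev /=.
rewrite [X in _ + X](_ : _ = \sum_(0 <= j < m.+1 | (2 * j <= m)%N)
    (if (2 * j == m)%N then 0 else w (m - j)%N)); last first.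
  rewrite big_nat_cond [RHS]big_nat_cond [RHS]big_mkcond [LHS]big_mkcond /=.
  apply: eq_bigr => j _; rewrite add0n subSS.
  case: (ltnP j m.+1) => [jm|]; rewrite ?andbF //=.
  have -> : (2 * (m - j) <= m)%N = (m <= 2 * j)%N by lia.
  by case: ltngtP.
rewrite -big_split /=; apply: eq_bigr => j jm; rewrite wE // /symX.
have -> : (m - 2 * j == 0)%N = (2 * j == m)%N by lia.
case: eqP => [<-|_]; first by rewrite subnn expr0 addr0.
by rewrite wE' // mulrDr.
Qed.

(** The change of variable m = k + 2j.  The left side is grouped by the
frequency k, as in the definition of U_k; the right side by the degree m, as in
the expansion of a polynomial. *)
Lemma sum_reindex_parity (V : nmodType) (G : nat -> nat -> nat -> V) (L : nat) :
  \sum_(0 <= k < L.+1) \sum_(0 <= j < L.+1 | (k + 2 * j <= L)%N)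
    G (k + 2 * j)%N j k =
  \sum_(0 <= m < L.+1) \sum_(0 <= j < m.+1 | (2 * j <= m)%N)
    G m j (m - 2 * j)%N.
Proof.
transitivity (\sum_(0 <= m < L.+1) \sum_(0 <= j < L.+1 | (2 * j <= m)%N)
                 G m j (m - 2 * j)%N); last first.
  apply: eq_big_nat => m mL.
  rewrite (big_nat_widen 0 m.+1 L.+1) //.
  by apply: eq_bigl => j; lia.
rewrite (exchange_big_dep_nat xpredT) //= [RHS](exchange_big_dep_nat xpredT) //=.
apply: eq_bigr => j _.
have -> : \sum_(0 <= m < L.+1 | (2 * j <= m)%N) G m j (m - 2 * j)%N =
          \sum_(0 + 2 * j <= m < L.+1) G m j (m - 2 * j)%N.
  by rewrite [RHS](big_nat_widenl _ 0).
rewrite big_addn [RHS](big_nat_widen _ _ L.+1) ?leq_subr //.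
rewrite [LHS]big_nat_cond [RHS]big_nat_cond; apply: eq_big; first by move=> k; lia.
by move=> k _; rewrite addnK.
Qed.

(** Both parities of k in the definition of U become one formula after the
shift p = j + l of the summation index, with degree m = k + 2j.  For k = 0 the
sum here also has the term j = 0, which the maximum in the definition leaves
out: it vanishes because it contains division by 0.  The hypothesis 0 < L
excludes U_1 at L = 0, where the truncated L - 1 would keep a term. *)
Lemma U_reindex (R : realType) (d : nat -> R) (L k : nat) : (0 < L)%N ->
  U d L k = \sum_(0 <= j < L.+1 | (k + 2 * j <= L)%N)
    d (k + 2 * j).-1 / (k + 2 * j)%:R / 2 ^+ (k + 2 * j) * 'C(k + 2 * j, j)%:R.
Proof.
move=> L0; rewrite /U; case: ifP => [kodd|keven].
  rewrite /Uodd -{1}[k./2]add0n big_addn (big_nat_widen _ _ L.+1); last lia.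
  apply: eq_big => [j|j _]; first lia.
  have -> : (2 * (j + k./2) + 1 = k + 2 * j)%N by lia.
  rewrite addnK; have -> : (2 * (j + k./2) = (k + 2 * j).-1)%N by lia.
  by rewrite mulrAC.
have -> : Ueven d L k./2 = \sum_(0 + k./2 <= p < (L./2).+1)
    d (2 * p - 1)%N / (2 * p)%:R * 'C(2 * p, p - k./2)%:R / 2 ^+ (2 * p).
  rewrite /Ueven add0n; case: k./2 => [|l]; last by rewrite (maxn_idPl _).
  rewrite [RHS]big_ltn //.
  by rewrite muln0 invr0 mulr0 !mul0r add0r.
rewrite big_addn (big_nat_widen _ _ L.+1); last lia.
apply: eq_big => [j|j _]; first lia.
have -> : (2 * (j + k./2) = k + 2 * j)%N by lia.
by rewrite addnK subn1 mulrAC.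
Qed.

(** The constant term is 0 because division by 0 gives 0. *)
Definition primitive {R : fieldType} (p : {poly R}) : {poly R} :=
  \poly_(m < (size p).+1) (p`_m.-1 / m%:R).

Lemma deriv_primitive (R : numFieldType) (p : {poly R}) : (primitive p)^`() = p.
Proof.
apply/polyP => i; rewrite coef_deriv coef_poly ltnS.
case: ltnP => [_|/leq_sizeP ->//]; last by rewrite mul0rn.
by rewrite -[_ *+ _]mulr_natr mulfVK // pnatr_eq0.
Qed.

(** The cosine expansion of the antiderivative, in the variable z. *)
Lemma sum_U_symX (R : realType) (p : {poly R}) (z : R[i]) (x : R) :
  p != 0 -> z != 0 -> z + z^-1 = (2 * x)%:C ->
  \sum_(0 <= k < (size p).+1) (U (nth 0 p) (size p) k)%:C * symX z k =
  (primitive p).[x]%:C.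
Proof.
move=> p0 z0 zx; rewrite horner_poly.
rewrite -(big_mkord xpredT (fun m => p`_m.-1 / m%:R * x ^+ m)).
pose G m j k := (p`_m.-1 / m%:R / 2 ^+ m)%:C * ('C(m, j)%:R * symX z k).
transitivity (\sum_(0 <= k < (size p).+1)
    \sum_(0 <= j < (size p).+1 | (k + 2 * j <= size p)%N) G (k + 2 * j)%N j k).
  apply: eq_bigr => k _; rewrite U_reindex ?lt0n ?size_poly_eq0 //.
  rewrite rmorph_sum mulr_suml; apply: eq_bigr => j _.
  by rewrite /G rmorphM rmorph_nat mulrA.
rewrite sum_reindex_parity rmorph_sum; apply: eq_bigr => m _.
rewrite /G -mulr_sumr -addV_expn // zx -(rmorphXn (real_complex R)) -rmorphM /=; congr _%:C.
by rewrite exprMn mulrA mulfVK // expf_neq0 // pnatr_eq0.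
Qed.

Lemma addV_unit_circle (R : rcfType) (z : R[i]) :
  `|z| = 1 -> z + z^-1 = (2 * complex.Re z)%:C.
Proof.
by move=> z1; rewrite invc_norm z1 expr1n invr1 mul1r addcJ rmorphM rmorph_nat.
Qed.

(** Factoring out z^L turns z^(L+k) + z^(L-k) into z^k + z^-k, so the factor
left is the cosine expansion without its constant term U_0, minus lambda. *)
Lemma horner_P2L (R : realType) (p : {poly R}) (lambda z : R[i]) (x : R) :
  p != 0 -> z != 0 -> z + z^-1 = (2 * x)%:C ->
  (P2L (nth 0 p) (size p) lambda).[z] =
  z ^+ size p *
    (((primitive p).[x] - U (nth 0 p) (size p) 0)%:C - lambda).
Proof.
move=> p0 z0 zx; rewrite rmorphB /= -(sum_U_symX _ _ _ _ p0 z0 zx).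
rewrite [in RHS]big_ltn // {1}/symX eqxx mulr1 [_%:C + _]addrC addrK.
rewrite /P2L hornerD hornerN hornerZ hornerXn horner_sum mulrBr mulr_sumr.
congr (_ - _); last by rewrite mulrC.
apply: eq_big_nat => -[//|k] /= kL.
rewrite hornerZ hornerD !hornerXn /symX /= [RHS]mulrCA; congr (_ * _).
by rewrite mulrDr -exprD exprVn exprB ?unitfE.
Qed.

Lemma ex_unit_circle (R : rcfType) (x : R) : x \in `[-1, 1] ->
  exists2 z : R[i], `|z| = 1 & complex.Re z = x.
Proof.
move=> xI; exists (x +i* Num.sqrt (1 - x ^+ 2)) => //.
have x2 : x ^+ 2 <= 1.
  by move: xI; rewrite in_itv /= => /andP[? ?]; nra.
by rewrite normc_def /= sqr_sqrtr ?subr_ge0 // addrC subrK sqrtr1.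
Qed.

Lemma Re_unit_circle (R : rcfType) (z : R[i]) :
  `|z| = 1 -> complex.Re z \in `[-1, 1].
Proof.
move=> z1; have := normc_ge_Re z; rewrite z1 (_ : 1 = 1%:C) // lecR.
by rewrite ler_norml in_itv.
Qed.

(** At z = e the number z^k + z^-k is 2 e^k: these are the end points of the
interval, read off the cosine expansion. *)
Lemma sum_U_endpoint (R : realType) (p : {poly R}) (e : R) : p != 0 -> e = 1 \/ e = -1 ->
  2 * \sum_(1 <= k < (size p).+1) e ^+ k * U (nth 0 p) (size p) k =
  (primitive p).[e] - U (nth 0 p) (size p) 0.
Proof.
move=> p0 e1.
have eV : e^-1 = e by case: e1 => ->; rewrite ?invrN invr1.
have e0 : e != 0 by case: e1 => ->; rewrite ?oppr_eq0 oner_eq0.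
apply: complexI; rewrite rmorphB /= -(sum_U_symX _ _ e%:C e p0); first last.
- by rewrite -fmorphV /= eV -rmorphD /= mulr_natl mulr2n.
- by rewrite fmorph_eq0.
rewrite [in RHS]big_ltn // {1}/symX eqxx mulr1 [_%:C + _]addrC addrK.
rewrite mulr_sumr rmorph_sum; apply: eq_big_nat => -[//|k] _.
rewrite /symX /= -fmorphV /= eV -rmorphXn -rmorphD -rmorphM /=; congr _%:C.
by rewrite mulrA mulr_natl mulr2n mulrC.
Qed.

(* The order of R[i] is x <= y iff 'Im x = 'Im y and 'Re x <= 'Re y, so an
   interval of R[i] with real endpoints is the usual real interval, seen in
   R[i]; equality of two intervals `[_, _] is equality of their endpoints. *)
Theorem mainTheorem3 (R : realType) (alpha beta : R) (N L : nat)
    (bt : {poly R}) (lambda : R[i])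
    (halpha : -1 < alpha) (hbeta : -1 < beta)
    (hbt : is_btilde alpha beta N bt)
    (hdeg : size bt = L) :
  let d := fun k : nat => bt`_k in
  let lo := (2 * \sum_(1 <= k < L.+1) (-1) ^+ k * U d L k)%:C in
  let hi := (2 * \sum_(1 <= k < L.+1) U d L k)%:C in
  ((forall z : R[i], `|z| = 1 -> ~~ root (P2L d L lambda) z) <->
     lambda \notin `[lo, hi]) /\
  `[lo, hi] = `[(-1) ^+ L * (P2Lt d L lambda).[-1], (P2Lt d L lambda).[1]].
Proof.
have bt_gt0 : forall x, x \in `[-1, 1] -> 0 < bt.[x].
  by case: hbt => ? [? [? [? [? []]]]].
have bt0 : bt != 0.
  apply/eqP => bt0; have := bt_gt0 0; rewrite bt0 horner0 ltxx in_itv /=.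
  by rewrite lerN10 ler01 => /(_ isT).
rewrite -{L}hdeg; cbv zeta.
change (fun k : nat => bt`_k) with (nth 0 bt).
pose f := primitive bt - (U (nth 0 bt) (size bt) 0)%:P.
have fE x : f.[x] = (primitive bt).[x] - U (nth 0 bt) (size bt) 0.
  by rewrite !hornerE.
have lo_f : 2 * \sum_(1 <= k < (size bt).+1)
    (-1) ^+ k * U (nth 0 bt) (size bt) k = f.[-1].
  by rewrite sum_U_endpoint ?fE //; right.
have hi_f : 2 * \sum_(1 <= k < (size bt).+1) U (nth 0 bt) (size bt) k = f.[1].
  rewrite fE -sum_U_endpoint //; last by left.
  by congr (2 * _); apply: eq_bigr => k _; rewrite expr1n mul1r.
have unit_neq0 (z : R[i]) : `|z| = 1 -> z != 0.
  by move=> z1; rewrite -normr_eq0 z1 oner_eq0.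
have rootE (z : R[i]) : `|z| = 1 ->
    root (P2L (nth 0 bt) (size bt) lambda) z = (f.[complex.Re z]%:C == lambda).
  move=> z1; have z0 := unit_neq0 z z1.
  rewrite rootE (horner_P2L _ _ _ _ _ bt0 z0 (addV_unit_circle _ _ z1)) -fE.
  by rewrite mulf_eq0 expf_eq0 (negPf z0) andbF subr_eq0.
have f_mono : {in `[-1, 1] &, {mono horner f : x y / x <= y}}.
  apply: ler_horner => x xI.
  rewrite derivB derivC subr0 deriv_primitive bt_gt0 //.
  exact: subset_itv_oo_cc.
have m1I : (-1 : R) \in `[-1, 1] by rewrite in_itv /= lexx; lra.
have p1I : (1 : R) \in `[-1, 1] by rewrite in_itv /= lexx; lra.
have P2LtE z (x : R) : z != 0 -> z + z^-1 = (2 * x)%:C ->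
    (P2Lt (nth 0 bt) (size bt) lambda).[z] = z ^+ size bt * f.[x]%:C.
  move=> z0 zx; rewrite /P2Lt hornerD hornerZ hornerXn.
  by rewrite (horner_P2L _ _ _ _ _ bt0 z0 zx) -fE mulrBr (mulrC lambda) subrK.
rewrite lo_f hi_f; split; last first.
  rewrite (P2LtE (-1) (-1)) ?(P2LtE 1 1) ?oppr_eq0 ?oner_eq0 //.
  - by rewrite expr1n mul1r mulrA -exprMn mulrNN mulr1 expr1n mul1r.
  - by rewrite invr1 mulr1 rmorph_nat.
  - by rewrite invrN invr1 mulrN1 rmorphN rmorph_nat mulr2n opprD.
(* Forget the body of f, which the evaluation lemmas would unfold. *)
clearbody f; rewrite in_itv /=; split => [noroot|].
  apply/negP => /andP[]; rewrite !lecE => /andP[/eqP /= im0 lo_le] /andP[_ le_hi].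
  have [||x xI] := @poly_ivt _ (f - (complex.Re lambda)%:P) (-1) 1.
  - lra.
  - by rewrite !hornerD !hornerN !hornerC subr_le0 subr_ge0 lo_le.
  rewrite /root hornerD hornerN hornerC subr_eq0 => /eqP fx.
  have [z z1 zx] := ex_unit_circle _ _ xI.
  have := noroot z z1; rewrite rootE // zx fx.
  by rewrite eq_complex /= eqxx im0 eqxx.
move=> lambdaN z z1; apply: contra lambdaN; rewrite rootE // => /eqP <-.
have zI := Re_unit_circle _ _ z1.
have /andP[? ?] : -1 <= complex.Re z <= 1 by move: zI; rewrite in_itv.
by rewrite !lecR !f_mono //; apply/andP.
Qed.
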